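(* Let $G$ be a connected graph of order $n$ and let $H$ be a connected graph. (i) If there exists a locating-dominating set $A$ of minimum cardinality in $H$ such that every vertex $v\in\overline{A}$ satisfies $N_A(v)\subsetneq A$, then $\gamma_{l-d}(G\odot H)=n\,\gamma_{l-d}(H)$. (ii) If for every locating-dominating set $B$ of minimum cardinality in $H$ there exists a vertex $u\in\overline{B}$ such that $N_B(u)=B$, then $\gamma_{l-d}(G\odot H)=n\,\gamma_{l-d}(H)+\gamma(G)$.
   Context: All graphs are finite, undirected, without loops or multiple edges. The order of a graph is its number of vertices. For graphs $G$ and $H$, where $G$ has vertices $v_1,\dots,v_{n}$, the corona graph $G\odot H$ is obtained from one copy of $G$ and $n$ copies of $H$ by joining by an edge each vertex of the $i$-th copy of $H$ with the vertex $v_i$ of $G$. For a set $X$ of vertices, $\overline{X}$ is its complement in the vertex set of the graph under consideration, and $N_X(v)$ is the set of neighbors of $v$ lying in $X$. A set $D$ of vertices is dominating if every vertex of $\overline{D}$ has a neighbor in $D$; $\gamma(G)$ is the minimum cardinality of a dominating set of $G$. A set $D$ of vertices is locating-dominating if it is dominating and $N_D(u)\neq N_D(v)$ for every pair of different vertices $u,v\in\overline{D}$; $\gamma_{l-d}(G)$ is the minimum cardinality of a locating-dominating set of $G$. *)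

(* Defs.v *)
From mathcomp Require Import all_boot.

Set Implicit Arguments.
Unset Strict Implicit.
Unset Printing Implicit Defensive.

Record sgraph := SGraph {
  vertex :> finType;
  adj : rel vertex;
  adj_sym : symmetric adj;
  adj_irr : irreflexive adj }.

(* The graph without vertices does not count as connected. *)
Definition connected (G : sgraph) : Prop :=
  0 < #|G| /\ forall x y : G, connect (@adj G) x y.

(* [inl x] is the vertex x of G; [inr (x, a)] is the vertex a in the copy of H
   attached to x. *)
Definition corona_adj (G H : sgraph) : rel (G + G * H)%type :=
  fun u v =>
    match u, v with
    | inl x, inl y => adj x y
    | inl x, inr (y, _) => x == y
    | inr (x, _), inl y => x == y
    | inr (x, a), inr (y, b) => (x == y) && adj a b
    end.

Lemma corona_adj_sym (G H : sgraph) : symmetric (@corona_adj G H).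
Proof.
move=> [x|[x a]] [y|[y b]] //=; rewrite ?[y == x]eq_sym //.
  exact: adj_sym.
by rewrite adj_sym.
Qed.

Lemma corona_adj_irr (G H : sgraph) : irreflexive (@corona_adj G H).
Proof. by move=> [x|[x a]] /=; rewrite ?eqxx adj_irr. Qed.

Definition corona (G H : sgraph) : sgraph :=
  SGraph (@corona_adj_sym G H) (@corona_adj_irr G H).

Definition nbrs (G : sgraph) (D : {set G}) (v : G) : {set G} :=
  [set w in D | adj v w].

Definition dominating (G : sgraph) (D : {set G}) : bool :=
  [forall v in ~: D, [exists w in D, adj v w]].

Definition locating_dominating (G : sgraph) (D : {set G}) : bool :=
  dominating D &&
  [forall u in ~: D, forall v in ~: D, (u != v) ==> (nbrs D u != nbrs D v)].

Lemma dominating_setT (G : sgraph) : dominating [set: G].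
Proof. by apply/forall_inP => v; rewrite setCT inE. Qed.

Lemma locating_dominating_setT (G : sgraph) : locating_dominating [set: G].
Proof.
by rewrite /locating_dominating dominating_setT; apply/forall_inP => v;
   rewrite setCT inE.
Qed.

(* [setT] is an admissible seed for both minima: [dominating_setT] and
   [locating_dominating_setT]. *)
Definition gamma (G : sgraph) : nat :=
  #|[arg min_(D < [set: G] | dominating D) #|D|]|.

Definition gamma_ld (G : sgraph) : nat :=
  #|[arg min_(D < [set: G] | locating_dominating D) #|D|]|.

Definition min_locating_dominating (G : sgraph) (D : {set G}) : bool :=
  locating_dominating D && (#|D| == gamma_ld G).

(* Main.v *)
(** Split the corona into the pieces consisting of a vertex x of G and its copy
    of H.  A locating-dominating set D restricts, on the copy, to a set that is
    locating and misses domination for at most one vertex, and this only if x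
    itself is in D; hence D has at least gamma_ld H elements in each piece.
    Under the hypothesis of (ii), a piece with exactly gamma_ld H elements
    cannot contain x, and some vertex of its copy is then adjacent to all of D
    in the piece; so x needs a neighbour in D among the vertices of G, and the
    pieces with more than gamma_ld H elements form a dominating set of G. *)

Require Import Defs.
From mathcomp Require Import all_boot.

Set Implicit Arguments.
Unset Strict Implicit.
Unset Printing Implicit Defensive.

(** * Domination and location in a single graph *)

Lemma dominatingP (G : sgraph) (D : {set G}) :
  reflect (forall v, v \notin D -> exists2 w, w \in D & adj v w) (dominating D).
Proof.
apply: (iffP forall_inP) => domD v.
  by rewrite -in_setC => /domD/exists_inP.
by rewrite in_setC => /domD/exists_inP.
Qed.

Lemma eq_nbrsP (G : sgraph) (D : {set G}) (u v : G) :
  reflect {in D, adj u =1 adj v} (nbrs D u == nbrs D v).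
Proof.
apply: (iffP eqP) => [/setP eqN w Dw | eqN].
  by move: (eqN w); rewrite !inE Dw.
by apply/setP=> w; rewrite !inE; case: (boolP (w \in D)) => // /eqN.
Qed.

Lemma nbrs_fullP (G : sgraph) (D : {set G}) (v : G) :
  reflect {in D, forall w, adj v w} (nbrs D v == D).
Proof.
apply: (iffP eqP) => [/setP fullN w Dw | fullN].
  by move: (fullN w); rewrite !inE Dw.
by apply/setP=> w; rewrite !inE; case: (boolP (w \in D)) => // /fullN.
Qed.

(** Kept apart from domination: the trace of a locating-dominating set on a copy of [H] always
    inherits the former, but may fail the latter. *)
Definition locating (G : sgraph) (D : {set G}) : Prop :=
  forall u v, u \notin D -> v \notin D -> {in D, adj u =1 adj v} -> u = v.

Lemma locating_dominatingP (G : sgraph) (D : {set G}) :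
  reflect (dominating D /\ locating D) (locating_dominating D).
Proof.
apply: (iffP andP) => -[domD locD]; split=> //.
  move=> u v Du Dv /eq_nbrsP eqN; apply/eqP/negPn/negP => neq_uv.
  move/forall_inP/(_ u): locD; rewrite inE => /(_ Du)/forall_inP/(_ v).
  by rewrite inE => /(_ Dv); rewrite neq_uv eqN.
apply/forall_inP=> u; rewrite inE => Du; apply/forall_inP=> v; rewrite inE => Dv.
by apply/implyP; apply: contra => /eq_nbrsP eqN; apply/eqP; apply: locD.
Qed.

Lemma gamma_le (G : sgraph) (D : {set G}) : dominating D -> gamma G <= #|D|.
Proof.
rewrite /gamma; case: arg_minnP => [|E _ minE]; first exact: dominating_setT.
exact: minE.
Qed.

Lemma gamma_witness (G : sgraph) :
  exists2 D : {set G}, dominating D & #|D| = gamma G.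
Proof.
rewrite /gamma; case: arg_minnP => [|E domE _]; first exact: dominating_setT.
by exists E.
Qed.

Lemma gamma_ld_le (G : sgraph) (D : {set G}) :
  locating_dominating D -> gamma_ld G <= #|D|.
Proof.
rewrite /gamma_ld; case: arg_minnP => [|E _ minE].
  exact: locating_dominating_setT.
exact: minE.
Qed.

Lemma min_locating_dominating_witness (G : sgraph) :
  exists D : {set G}, min_locating_dominating D.
Proof.
exists [arg min_(D < [set: G] | locating_dominating D) #|D|].
rewrite /min_locating_dominating eqxx andbT.
by case: arg_minnP => //; apply: locating_dominating_setT.
Qed.

(** Enlarging a set preserves location, and [v], being [u] or a neighbour of it, repairs the only
    failure of domination. *)
Lemma locating_dominating_setU1 (G : sgraph) (D : {set G}) (u v : G) :
    locating D -> u \notin D ->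
    (forall w, w \notin D -> w != u -> exists2 z, z \in D & adj w z) ->
    {in D, forall z, ~~ adj u z} -> (u == v) || adj u v ->
  locating_dominating (v |: D).
Proof.
move=> locD Du domD isoD uv; apply/locating_dominatingP; split.
  apply/dominatingP=> w; rewrite !inE negb_or => /andP[neq_wv Dw].
  have [eq_wu | neq_wu] := eqVneq w u; last first.
    by have [z Dz wz] := domD w Dw neq_wu; exists z; rewrite // !inE Dz orbT.
  exists v; first by rewrite !inE eqxx.
  by rewrite eq_wu in neq_wv *; rewrite (negPf neq_wv) in uv.
move=> w z; rewrite !inE !negb_or => /andP[_ Dw] /andP[_ Dz] eqN.
by apply: locD => // t Dt; apply: eqN; rewrite !inE Dt orbT.
Qed.

(** * Counting by pieces of the corona, and the sets that give the upper bounds *)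

Section Corona.

Variables G H : sgraph.
Implicit Types (D : {set corona G H}) (x y : G) (a b : H).

Definition corona_trace D x : {set H} :=
  [set a | (inr (x, a) : corona G H) \in D].

Definition corona_weight D x : nat :=
  ((inl x : corona G H) \in D) + #|corona_trace D x|.

Lemma card_corona_set D : #|D| = \sum_x corona_weight D x.
Proof.
rewrite -sum1_card big_mkcond /= big_sumType /= big_split /=; congr (_ + _).
rewrite (eq_bigr (fun x => \sum_a ((inr (x, a) : corona G H) \in D : nat))).
  by rewrite pair_big /=; apply: eq_bigr => -[x a] _; case: (_ \in _).
move=> x _; rewrite -sum1_card big_mkcond /=.
by apply: eq_bigr => a _; rewrite inE; case: (_ \in _).
Qed.

Definition corona_set (C : {set G}) (A : {set H}) : {set corona G H} :=
  [set u | match u with inl x => x \in C | inr (_, a) => a \in A end].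

Lemma card_corona_set_product (C : {set G}) (A : {set H}) :
  #|corona_set C A| = #|G| * #|A| + #|C|.
Proof.
rewrite card_corona_set big_split /= addnC -sum_nat_const; congr (_ + _).
  apply: eq_bigr => x _; congr #|pred_of_set _|.
  by apply/setP=> a; rewrite !inE.
rewrite -[RHS]sum1_card [RHS]big_mkcond.
by apply: eq_bigr => x _; rewrite inE; case: (_ \in _).
Qed.

(** The only possible clash is between a vertex of [G] outside [C] and a vertex of its own copy
    adjacent to all of [A]; a neighbour in [C] of the former separates the two. *)
Lemma locating_dominating_corona_set (C : {set G}) (A : {set H}) :
    0 < #|H| -> locating_dominating A ->
    (forall x a, x \notin C -> a \notin A -> {in A, forall b, adj a b} ->
       exists2 y, y \in C & adj x y) ->
  locating_dominating (corona_set C A).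
Proof.
move=> /card_gt0P[h _] /locating_dominatingP[/dominatingP domA locA] fullA.
(* The vertex [a0] in the copy attached to [x] dominates [x] and tells it from the other vertices of
   [G]. *)
have [a0 Aa0] : exists a0, a0 \in A.
  case: (boolP (h \in A)) => [Ah | /domA[b Ab _]]; first by exists h.
  by exists b.
have inr_inl x b y : inr (x, b) \notin corona_set C A ->
    inl y \notin corona_set C A ->
    ~ {in corona_set C A, @adj (corona G H) (inr (x, b)) =1
                          @adj (corona G H) (inl y)}.
  rewrite !inE => Ab Cy eqN.
  have eq_xy : x = y.
    have := eqN (inr (y, a0)); rewrite inE /= eqxx => /(_ Aa0).
    by case/andP => /eqP.
  have [|z Cz yz] := fullA y b Cy Ab.
    move=> c Ac; have := eqN (inr (y, c)); rewrite inE /= eq_xy eqxx /=.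
    exact.
  have := eqN (inl z); rewrite inE /= eq_xy yz => /(_ Cz)/eqP eq_yz.
  by rewrite eq_yz adj_irr in yz.
apply/locating_dominatingP; split.
  apply/dominatingP=> -[x | [x a]]; rewrite inE => notin.
    by exists (inr (x, a0)); rewrite ?inE //= eqxx.
  by have [b Ab ab] := domA a notin; exists (inr (x, b)); rewrite ?inE //= eqxx.
move=> [x | [x a]] [y | [y b]] Du Dv eqN.
- have := eqN (inr (x, a0)); rewrite inE /= eqxx => /(_ Aa0)/esym/eqP.
  by move->.
- by case: (inr_inl y b x Dv Du) => w Dw; rewrite eqN.
- by case: (inr_inl x a y Du Dv).
rewrite !inE in Du Dv.
have eq_xy : x = y.
  have [c Ac ac] := domA a Du; have := eqN (inr (x, c)).
  by rewrite inE /= eqxx ac => /(_ Ac)/esym/andP[/eqP].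
rewrite -{}eq_xy in eqN *; congr (inr (_, _)); apply: locA => // c Ac.
by have := eqN (inr (x, c)); rewrite inE /= eqxx; apply.
Qed.

(** * Traces of a locating-dominating set on the copies, and the lower bounds *)

Section Trace.

Variable D : {set corona G H}.
Hypothesis ldD : locating_dominating D.

(** No vertex outside a copy can separate two vertices of it: [inl x] is adjacent to the whole copy,
    all the others to none of it. *)
Lemma locating_corona_trace x : locating (corona_trace D x).
Proof.
have [_ locD] := locating_dominatingP _ ldD.
move=> a b; rewrite !inE => Da Db eqN.
suff [] : (inr (x, a) : corona G H) = inr (x, b) by [].
apply: locD => // -[y | [y c]] Dw //=.
by have [eq_xy | //] := eqVneq x y; apply: eqN; rewrite inE eq_xy.
Qed.

Lemma corona_trace_dominated x a :
    a \notin corona_trace D x ->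
  (exists2 b, b \in corona_trace D x & adj a b) \/ (inl x : corona G H) \in D.
Proof.
have [/dominatingP domD _] := locating_dominatingP _ ldD.
rewrite inE => /domD[[y | [y b]] Dw] /=; first by move/eqP->; right.
by case/andP=> /eqP-> ab; left; exists b; rewrite ?inE.
Qed.

(** Two vertices outside the trace without neighbours in it would have the same empty neighbourhood,
    so there is at most one, [a]. The choice of [b] is left free: [b = a] gives the weight bound, a
    neighbour of [a] the exchange in [corona_weight_min]. *)
Lemma corona_trace_cases x :
  locating_dominating (corona_trace D x) \/
  exists a, [/\ (inl x : corona G H) \in D, a \notin corona_trace D x
    & forall b, (a == b) || adj a b ->
        locating_dominating (b |: corona_trace D x)].
Proof.
have loc := @locating_corona_trace x.
case: (boolP (dominating (corona_trace D x))) => [dom | ].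
  by left; apply/locating_dominatingP.
move=> /forall_inPn[a]; rewrite in_setC => Da.
move=> /exists_inPn isoa; right; exists a; split=> //.
  by have [[b Db ab] | //] := corona_trace_dominated Da; case/negP: (isoa b Db).
move=> b; apply: (locating_dominating_setU1 loc Da) => // c Dc neq_ca.
apply/exists_inP; apply: contraNT neq_ca => /exists_inPn isoc; apply/eqP.
apply: loc => // d Dd.
by rewrite (negPf (isoc d Dd)) (negPf (isoa d Dd)).
Qed.

Lemma corona_weight_ge x : gamma_ld H <= corona_weight D x.
Proof.
rewrite /corona_weight; have [/gamma_ld_le le_g | ] := corona_trace_cases x.
  exact: leq_trans le_g (leq_addl _ _).
(* Here [inl x], lying in [D], pays for adding [a] to the trace. *)
case=> a [-> Da /(_ a)]; rewrite eqxx => /(_ isT)/gamma_ld_le.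
by rewrite cardsU1 Da.
Qed.

Hypothesis full_min : forall B : {set H}, min_locating_dominating B ->
  exists u : H, u \in ~: B /\ nbrs B u = B.

(* If x were in D, a vertex a of the trace's complement would complete the
   trace to a minimum set B; a vertex w adjacent to all of B could replace a,
   and the vertex adjacent to all of the new set would have the same
   neighbours in the trace as w. *)
Lemma corona_weight_min x :
    corona_weight D x = gamma_ld H ->
  (inl x : corona G H) \notin D /\ min_locating_dominating (corona_trace D x).
Proof.
rewrite /corona_weight /min_locating_dominating => weightE.
have [ldT | [a [Dx Da ldT]]] := corona_trace_cases x.
  have := gamma_ld_le ldT; rewrite -weightE ldT /=.
  by case: (_ \in D) => //=; rewrite ?add0n ?eqxx // add1n ltnn.
have minT b : (a == b) || adj a b -> b \notin corona_trace D x ->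
    min_locating_dominating (b |: corona_trace D x).
  move=> ab Db.
  by rewrite /min_locating_dominating ldT // cardsU1 Db -weightE Dx /=.
have [||w [Bw /eqP/nbrs_fullP fullw]] := full_min (minT a _ _) => //.
  by rewrite eqxx.
move: Bw; rewrite !inE negb_or => /andP[_ Dw].
have aw : adj a w by rewrite adj_sym fullw // !inE eqxx.
have Tw : w \notin corona_trace D x by rewrite inE.
have [||z [Bz /eqP/nbrs_fullP fullz]] := full_min (minT w _ _) => //.
  by rewrite aw orbT.
move: Bz; rewrite in_setC in_setU1 negb_or => /andP[/eqP neq_zw Tz].
case: neq_zw; apply: (locating_corona_trace Tz Tw) => c Dc.
by rewrite fullz ?fullw // in_setU1 Dc orbT.
Qed.

Lemma dominating_heavy_corona :
  dominating [set x | gamma_ld H < corona_weight D x].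
Proof.
have light x : ~~ (gamma_ld H < corona_weight D x) ->
    corona_weight D x = gamma_ld H.
  by move=> le_w; apply/eqP; rewrite eqn_leq corona_weight_ge leqNgt le_w.
have [_ locD] := locating_dominatingP _ ldD.
apply/dominatingP=> x; rewrite inE => /light/corona_weight_min[Dx minT].
have [u [Tu /eqP/nbrs_fullP fullu]] := full_min minT.
rewrite !inE in Tu.
apply/exists_inP; apply: contraT => /exists_inPn noN.
(* Both vertices see exactly the trace of [D] on this copy: [x] is not in [D], and any [y] of [G] in
   [D] has a heavy piece, hence is not adjacent to [x]. *)
suff : (inl x : corona G H) = inr (x, u) by [].
apply: locD => // -[y | [y b]] Dw /=.
  have [eq_xy | _] := eqVneq x y; first by rewrite -eq_xy (negPf Dx) in Dw.
  apply/negbTE/noN; rewrite inE; apply/negPn/negP => /light/corona_weight_min[].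
  by rewrite Dw.
have [eq_xy | //] := eqVneq x y.
by rewrite /= fullu // inE eq_xy.
Qed.

End Trace.

End Corona.

Theorem theorem14 (G H : sgraph) (n : nat) (order_G : #|G| = n)
    (connected_G : connected G) (connected_H : connected H) :
  ((exists A : {set H}, min_locating_dominating A /\
      forall v : H, v \in ~: A -> nbrs A v \proper A) ->
   gamma_ld (corona G H) = n * gamma_ld H) /\
  ((forall B : {set H}, min_locating_dominating B ->
      exists u : H, u \in ~: B /\ nbrs B u = B) ->
   gamma_ld (corona G H) = n * gamma_ld H + gamma G).
Proof.
have [H_gt0 _] := connected_H.
have [D /andP[ldD /eqP cardD]] := min_locating_dominating_witness (corona G H).
rewrite -{n}order_G; split.
  case=> A [/andP[ldA /eqP cardA] properA]; apply/eqP; rewrite eqn_leq.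
  apply/andP; split.
    (* Copies of [A] suffice, with [C] empty: by properness no vertex outside [A] is adjacent to all
       of [A]. *)
    rewrite -cardA -[leqRHS]addn0 -(cards0 G) -card_corona_set_product.
    apply: gamma_ld_le; apply: locating_dominating_corona_set => // x a _ Aa.
    move=> /nbrs_fullP/eqP fulla; have := properA a.
    by rewrite inE Aa fulla properxx => /(_ isT).
  rewrite -cardD card_corona_set -sum_nat_const.
  by apply: leq_sum => x _; apply: corona_weight_ge.
move=> full_min; apply/eqP; rewrite eqn_leq; apply/andP; split.
  have [A /andP[ldA /eqP cardA]] := min_locating_dominating_witness H.
  have [C /dominatingP domC cardC] := gamma_witness G.
  rewrite -cardA -cardC -card_corona_set_product.
  apply: gamma_ld_le; apply: locating_dominating_corona_set => // x a Cx _ _.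
  exact: domC.
rewrite -cardD card_corona_set.
have domS := dominating_heavy_corona ldD full_min.
(* The bound now splits over the pieces: each weighs at least [gamma_ld H], and each heavy one
   supplies the extra unit that counts it in the dominating set. *)
apply: leq_trans (leq_add (leqnn _) (gamma_le domS)) _.
rewrite -sum_nat_const -sum1_card [X in _ + X]big_mkcond -big_split /=.
apply: leq_sum => x _; rewrite inE.
case: ifP => [|_]; first by rewrite addn1.
by rewrite addn0; apply: corona_weight_ge.
Qed.
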